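(* Let $x$ be a prompt, $\mathcal{Y}$ a finite or countable set of responses, $\pi_{\mathrm{inst}}(\cdot\mid x)$ a probability distribution on $\mathcal{Y}$, $r(x,\cdot):\mathcal{Y}\to\{0,1\}$ a binary reward, and $\beta>0$. For $\lambda\in\mathbb{R}$ let $$\pi_\lambda(y\mid x)=\frac{1}{Z_\lambda(x)}\,\pi_{\mathrm{inst}}(y\mid x)\exp\big(\lambda\, r(x,y)\big),\qquad Z_\lambda(x)=\sum_{y\in\mathcal{Y}}\pi_{\mathrm{inst}}(y\mid x)\exp\big(\lambda\, r(x,y)\big),$$ and let $\pi_{\mathrm{reas}}(y\mid x)=\frac{1}{Z(x)}\pi_{\mathrm{inst}}(y\mid x)\exp\big(\tfrac{1}{\beta}r(x,y)\big)$ with $Z(x)=\sum_{y\in\mathcal{Y}}\pi_{\mathrm{inst}}(y\mid x)\exp\big(\tfrac1\beta r(x,y)\big)$. Let $R_\lambda(x)=\mathbb{E}_{y\sim\pi_\lambda(\cdot\mid x)}[r(x,y)]$ and $R_{\mathrm{reas}}(x)=\mathbb{E}_{y\sim\pi_{\mathrm{reas}}(\cdot\mid x)}[r(x,y)]$. Then $$\mathrm{KL}\big(\pi_{\mathrm{reas}}(\cdot\mid x)\,\|\,\pi_\lambda(\cdot\mid x)\big)=D_{\mathrm{Bern}}\big(R_{\mathrm{reas}}(x)\,\|\,R_\lambda(x)\big).$$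
   Context: $D_{\mathrm{Bern}}(p\|q)=p\log\frac{p}{q}+(1-p)\log\frac{1-p}{1-q}$ is the KL divergence between the Bernoulli distributions with parameters $p$ and $q$, and $\mathrm{KL}(P\|Q)=\sum_y P(y)\log\frac{P(y)}{Q(y)}$; terms with vanishing first argument are $0$ (convention $0\log\frac{0}{q}=0$ for all $q\ge 0$). The distribution $\pi_{\mathrm{reas}}$ is the optimal policy of KL-regularized reward maximization with reward $r$, coefficient $\beta$ and reference policy $\pi_{\mathrm{inst}}$. *)

(* Defs.v *)
From HB Require Import structures.
From mathcomp Require Import all_boot all_order all_algebra.
From mathcomp Require Import all_classical all_reals all_analysis.

Set Implicit Arguments.
Unset Strict Implicit.
Unset Printing Implicit Defensive.
Import Order.TTheory GRing.Theory Num.Theory.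
Local Open Scope classical_set_scope.
Local Open Scope ring_scope.

(* [esum] is a supremum over finite subsets, hence a sum only for nonnegative
   terms; a series with terms of both signs is split into its two parts, as in
   [summable_eseries_esum]. *)
Definition ssum (R : realType) (Y : countType) (f : Y -> \bar R) : \bar R :=
  (\esum_(y in [set: Y]) (f^\+ y) - \esum_(y in [set: Y]) (f^\- y))%E.

Definition is_distr (R : realType) (Y : countType) (p : Y -> R) : Prop :=
  (forall y, 0 <= p y) /\ ssum (fun y => (p y)%:E) = 1%E.

Definition expect (R : realType) (Y : countType) (p f : Y -> R) : R :=
  fine (ssum (fun y => (p y * f y)%:E)).

Definition partition_fun (R : realType) (Y : countType)
    (p f : Y -> R) (c : R) : R :=
  fine (ssum (fun y => (p y * expR (c * f y))%:E)).

Definition tilt (R : realType) (Y : countType)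
    (p f : Y -> R) (c : R) (y : Y) : R :=
  (partition_fun p f c)^-1 * (p y * expR (c * f y)).

(* [a * log (a / b)], with [0 log (0 / b) = 0] for every [b >= 0], and the value
   [+oo] when [0 < a] and [b = 0], where division by zero in [R] would give a
   meaningless finite value. *)
Definition kl_term (R : realType) (a b : R) : \bar R :=
  if a == 0 then 0%E else if b == 0 then +oo%E else (a * ln (a / b))%:E.

Definition KL (R : realType) (Y : countType) (p q : Y -> R) : \bar R :=
  ssum (fun y => kl_term (p y) (q y)).

Definition D_Bern (R : realType) (p q : R) : \bar R :=
  (kl_term p q + kl_term (1 - p) (1 - q))%E.

(* Main.v *)
(** Since the reward is binary, a tilt multiplies the reference law by one constant
    on the event [r = 1] and by another on its complement. The likelihood ratio of
    two tilts therefore depends on [r] only, and the divergence reduces to that of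
    the two laws of [r], which are Bernoulli. *)

Require Import Defs.
From HB Require Import structures.
From mathcomp Require Import all_boot all_order all_algebra.
From mathcomp Require Import all_classical all_reals all_analysis.
From mathcomp Require Import ring lra.
Import Order.TTheory GRing.Theory Num.Theory.
Local Open Scope ring_scope.

Lemma ge0_esumZl (R : realType) (T : choiceType) (D : set T) (a : T -> \bar R)
    (c : R) :
  0 <= c -> (forall i, 0 <= a i)%E ->
  \esum_(i in D) (c%:E * a i)%E = (c%:E * \esum_(i in D) a i)%E.
Proof.
move=> c0 a0; rewrite /esum -ereal_supZl //; last first.
  (* Scaling commutes with a supremum over a nonempty set; the empty partial sum is a witness. *)
  apply/set0P; exists 0%E; exists set0; last by rewrite fsbig_set0.
  exact: fsets_set0.
congr ereal_sup; rewrite image_comp; apply: eq_imagel => A [finA _] /=.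
by rewrite ge0_mule_fsumr.
Qed.

Lemma ge0_ssum (R : realType) (Y : countType) (f : Y -> \bar R) :
  (forall y, 0 <= f y)%E -> ssum f = \esum_(y in [set: Y]%classic) f y.
Proof.
move=> f0; rewrite /ssum [X in (_ - X)%E]esum1 ?sube0.
  by apply: eq_esum => y _; rewrite (@ge0_funeposE _ _ setT) ?inE.
by move=> y _; rewrite (@ge0_funenegE _ _ setT) ?inE.
Qed.

(** Here [s] is the mass that [p] gives to [P]. It is chosen before [a] and [b], so that one [s]
    serves the partition functions, the expectations and the divergence; the last needs [a] and [b]
    of any sign, as log-ratios may be negative. *)
Lemma ssum_two_valued (R : realType) (Y : countType) (p : Y -> R) (P : pred Y) :
  is_distr p ->
  exists2 s : R, 0 <= s <= 1 & forall a b : R,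
    ssum (fun y => (p y * (if P y then a else b))%:E) =
    (s * a + (1 - s) * b)%:E.
Proof.
move=> [p0 p1].
pose f y := (if P y then p y else 0)%:E; pose g y := (if P y then 0 else p y)%:E.
have f0 y : (0 <= f y)%E by rewrite /f lee_fin; case: ifP.
have g0 y : (0 <= g y)%E by rewrite /g lee_fin; case: ifP.
have F0 : (0 <= \esum_(y in [set: Y]%classic) f y)%E by apply: esum_ge0.
have G0 : (0 <= \esum_(y in [set: Y]%classic) g y)%E by apply: esum_ge0.
have FG : (\esum_(y in [set: Y]%classic) f y +
           \esum_(y in [set: Y]%classic) g y = 1)%E.
  rewrite -esumD // -p1 ge0_ssum; last by move=> y; rewrite lee_fin.
  by apply: eq_esum => y _; rewrite /f /g -EFinD; case: ifP; rewrite ?addr0 ?add0r.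
have [s [sF tG]] : exists s : R, \esum_(y in [set: Y]%classic) f y = s%:E /\
    \esum_(y in [set: Y]%classic) g y = (1 - s)%:E.
  (* Two nonnegative masses with total 1 are both finite. *)
  move: F0 G0 FG; case: (\esum_(y in _) f y) => [s| |] //;
    case: (\esum_(y in _) g y) => [t| |] // _ _ [st].
  by exists s; rewrite -st [s + t]addrC addrK.
have s01 : 0 <= s <= 1.
  by move: F0 G0; rewrite sF tG !lee_fin subr_ge0 => -> ->.
have ge0 (a b : R) : 0 <= a -> 0 <= b ->
    \esum_(y in [set: Y]%classic) (p y * (if P y then a else b))%:E =
    (s * a + (1 - s) * b)%:E.
  move=> a0 b0.
  transitivity (\esum_(y in [set: Y]%classic) (a%:E * f y + b%:E * g y)%E).
    apply: eq_esum => y _; rewrite /f /g -!EFinM -EFinD.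
    by case: ifP => _; congr EFin; ring.
  rewrite esumD => [|y _|y _]; [|exact: mule_ge0 ..].
  by rewrite !ge0_esumZl // sF tG -!EFinM -EFinD; congr EFin; ring.
exists s => // a b; rewrite /ssum.
(* As [p y >= 0], the positive part acts on [a] and [b] alone, which leaves a nonnegative two-valued
   sum; the negative part behaves likewise. *)
have -> : \esum_(y in [set: Y]%classic)
    ((fun y => (p y * (if P y then a else b))%:E)^\+%E y) =
    (s * Num.max a 0 + (1 - s) * Num.max b 0)%:E.
  rewrite -ge0 ?le_max ?lexx ?orbT //.
  apply: eq_esum => y _; rewrite funeposE -EFin_max.
  by case: ifP => _; rewrite maxr_pMr // mulr0.
have -> : \esum_(y in [set: Y]%classic)
    ((fun y => (p y * (if P y then a else b))%:E)^\-%E y) =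
    (s * Num.max (- a) 0 + (1 - s) * Num.max (- b) 0)%:E.
  rewrite -ge0 ?le_max ?lexx ?orbT //.
  apply: eq_esum => y _; rewrite funenegE -EFinN -EFin_max.
  by case: ifP => _; rewrite maxr_pMr // mulr0 mulrN.
have maxB (c : R) : Num.max c 0 - Num.max (- c) 0 = c.
  by rewrite !maxEle oppr_le0; case: (leP c 0) => ? //;
    case: (leP 0 c) => ? //; lra.
rewrite -EFinB -[in RHS](maxB a) -[in RHS](maxB b); congr EFin; ring.
Qed.

(** A common weight cancels in the ratio; if [t = 0], both sides vanish by convention. Positivity of
    [v] keeps the term off the [+oo] branch. The weight is [pi_inst x y] in the divergence, and [s]
    or [1 - s] in the Bernoulli terms. *)
Lemma kl_term_scale (R : realType) (t u v : R) : 0 < u -> 0 < v ->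
  kl_term (t * u) (t * v) = (t * (u * ln (u / v)))%:E.
Proof.
move=> u0 v0; rewrite /kl_term !mulf_eq0 !(gt_eqF u0) !(gt_eqF v0) !orbF.
by case: eqVneq => [->|t0]; rewrite ?mul0r // -mulf_div divff // mul1r mulrA.
Qed.

Theorem theorem5p1 (R : realType) (X : Type) (Y : countType)
    (pi_inst r : X -> Y -> R) (beta lambda : R) (x : X)
    (hpi : is_distr (pi_inst x))
    (hr : forall y : Y, r x y = 0 \/ r x y = 1)
    (hbeta : 0 < beta) :
  let pi_lambda := tilt (pi_inst x) (r x) lambda in
  let pi_reas := tilt (pi_inst x) (r x) (1 / beta) in
  let R_lambda := expect pi_lambda (r x) in
  let R_reas := expect pi_reas (r x) in
  KL pi_reas pi_lambda = D_Bern R_reas R_lambda.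
Proof.
have [s /andP[s0 s1] sumE] := ssum_two_valued _ _ _ (fun y => r x y == 1) hpi.
(* With [s] the reference probability of reward 1, this is the partition function in closed form. *)
pose Z c : R := s * expR c + (1 - s).
have Z0 c : 0 < Z c.
  rewrite /Z; have e0 := expR_gt0 c; have [->|sn0] := eqVneq s 0; first by lra.
  by rewrite ltr_pwDl ?subr_ge0 // mulr_gt0 // lt_def sn0.
have rE (y : Y) (h : R -> R) : h (r x y) = if r x y == 1 then h 1 else h 0.
  by case: (hr y) => ->; rewrite ?eqxx // eq_sym oner_eq0.
have pfE c : partition_fun (pi_inst x) (r x) c = Z c.
  rewrite /partition_fun; under eq_fun => y do
    rewrite (rE _ (fun t => expR (c * t))).
  by rewrite sumE mulr1 mulr0 expR0 mulr1.
have tiltE c y : tilt (pi_inst x) (r x) c y =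
    pi_inst x y * (if r x y == 1 then expR c / Z c else 1 / Z c).
  rewrite /tilt pfE (rE _ (fun t => expR (c * t))) mulr1 mulr0 expR0.
  by case: ifP => _; ring.
have expE c : expect (tilt (pi_inst x) (r x) c) (r x) = s * (expR c / Z c).
  rewrite /expect (_ : (fun y => _) = fun y =>
      (pi_inst x y * (if r x y == 1 then expR c / Z c else 0))%:E).
    by rewrite sumE mulr0 addr0.
  apply: funext => y; rewrite tiltE -mulrA (rE y (fun t => _ * t)) mulr1 mulr0.
  by case: (r x y == 1).
(* The probability of reward 0 as weight times tilting factor, the form that [kl_term_scale]
   expects. *)
have compl c : 1 - s * (expR c / Z c) = (1 - s) * (1 / Z c).
  have Zn0 : Z c != 0 by rewrite gt_eqF.
  by apply: (mulIf Zn0); rewrite mulrBl -!mulrA !mulVf // !mulr1 /Z; ring.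
move=> /=; rewrite /KL /D_Bern !expE !compl.
have w1 c : 0 < expR c / Z c by rewrite divr_gt0 ?expR_gt0.
have w0 c : 0 < 1 / Z c by rewrite divr_gt0.
(* The two Bernoulli terms now read [s * a + (1 - s) * b]; [sumE] backwards spreads them over the
   responses, and the two series agree term by term. *)
rewrite !kl_term_scale // -EFinD -sumE; congr ssum; apply: funext => y.
by rewrite !tiltE; case: ifP => _; rewrite kl_term_scale.
Qed.
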